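(* Let $z_1,\ldots,z_k$ be distinct numbers with $\operatorname{Im}z_j>0$, let $l_1,\ldots,l_k$ be positive integers, and let $r=l_1+l_2+\cdots+l_k\le n-1$. Let $J$ be an $n\times n$ Jacobi matrix with diagonal entries $b_1,\ldots,b_n$ and off-diagonal entries $a_1,\ldots,a_{n-1}$ satisfying $\operatorname{Im} b_1>0$, $b_i\in\mathbb{R}$ for $i=2,\ldots,n$, and $a_i>0$ for $i=1,\ldots,n-1$. Suppose that the eigenvalues $z_1,\ldots,z_k$ of $J$ with their algebraic multiplicities $l_1,\ldots,l_k$ are known, as well as $b_1,a_1,b_2,\ldots,a_{n-r-1},b_{n-r}$. Then $a_{n-r},b_{n-r+1},\ldots,a_{n-1},b_n$ are uniquely determined. That is, if $J$ and $J'$ are two $n\times n$ Jacobi matrices satisfying these conditions, each having $z_1,\ldots,z_k$ as eigenvalues of algebraic multiplicities $l_1,\ldots,l_k$ respectively, and having the same entries $b_1,a_1,b_2,\ldots,a_{n-r-1},b_{n-r}$, then $J=J'$.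
   Context: An $n\times n$ Jacobi matrix with entries $b_1,\ldots,b_n$, $a_1,\ldots,a_{n-1}$ is the tri-diagonal matrix with diagonal entries $b_1,\ldots,b_n$ and with the entries in positions $(i,i+1)$ and $(i+1,i)$ both equal to $a_i$, $i=1,\ldots,n-1$. *)

(* Defs.v *)
From mathcomp Require Import all_boot all_order all_algebra.

Set Implicit Arguments.
Unset Strict Implicit.
Unset Printing Implicit Defensive.

Import GRing.Theory.
Local Open Scope ring_scope.

(* Entries are numbered from 1, whereas matrix indices i : 'I_n start at 0:
   only b 1, ..., b n and a 1, ..., a (n - 1) occur in the matrix. *)
Definition jacobi_mx (C : nzRingType) (n : nat) (b a : nat -> C) : 'M[C]_n :=
  \matrix_(i < n, j < n)
    if i == j then b i.+1
    else if j == i.+1 :> nat then a i.+1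
    else if i == j.+1 :> nat then a j.+1
    else 0.

Definition eigenvalue_of_multiplicity (F : fieldType) (n : nat)
    (A : 'M[F]_n) (z : F) (l : nat) : Prop :=
  eigenvalue A z /\ mup z (char_poly A) = l.

(* Main.v *)
(* Put m = n - r.  Expanding along the known block, the characteristic polynomial
   is P Q - U S, where P and U depend only on the given entries and are coprime,
   Q is the real monic characteristic polynomial of the trailing r x r block, and
   S is a_m^2 times that of the trailing (r-1) x (r-1) block.  For a second matrix
   with data Q', S', the Wronskian Q S' - Q' S vanishes at the z_j with the
   prescribed multiplicities; being real it vanishes at their conjugates too, so
   it has 2r zeros but degree less than 2r, and is zero.  Coprimality of Q and S
   gives Q = Q' and S = S', and the Euclidean algorithm on (Q, S) reads off the
   remaining entries. *)
Require Import Defs.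
From mathcomp Require Import all_boot all_order all_algebra.
From mathcomp Require Import reals complex.
From mathcomp Require Import ring zify.

Set Implicit Arguments.
Unset Strict Implicit.
Unset Printing Implicit Defensive.

Import Order.TTheory GRing.Theory Num.Theory.
Local Open Scope ring_scope.

(** * Characteristic polynomials as continuants *)

(** Laplace expansion along the first row, which has only two nonzero entries. *)
Lemma det_jacobi_rec (A : comNzRingType) (n : nat) (b a : nat -> A) :
  \det (jacobi_mx n.+2 b a) =
    b 1%N * \det (jacobi_mx n.+1 (b \o succn) (a \o succn))
    - a 1%N ^+ 2 * \det (jacobi_mx n (b \o succn \o succn) (a \o succn \o succn)).
Proof.
rewrite (expand_det_row _ 0) 2!big_ord_recl big1 ?addr0; last first.
  by move=> i _; rewrite !mxE mul0r.
rewrite !mxE /= /cofactor /= expr0 mul1r expr1 mulN1r mulrN; congr (_ * _ - _).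
  congr (\det _); apply/matrixP=> i j; rewrite !mxE /= (inj_eq lift_inj).
  by rewrite /bump !add1n !eqSS.
(* In the minor of the entry [a 1], the first column is zero below its top entry, again [a 1]; this
   gives the square. *)
rewrite (expand_det_col _ 0) big_ord_recl big1 ?addr0; last first.
  by move=> i _; rewrite !mxE mul0r.
rewrite !mxE /= /cofactor /= expr0 mul1r expr2 mulrA; congr (_ * _).
congr (\det _); apply/matrixP=> i j; rewrite !mxE -!val_eqE /=.
by rewrite /bump /= !add1n !eqSS /=.
Qed.

(* [continuant b a d.+1 i] is the characteristic polynomial of the d x d
   Jacobi block with diagonal b_i, ..., b_(i+d-1); the index is shifted so that
   [continuant b a 0 i = 0] lets the recurrence hold for blocks of size 1. *)
Fixpoint continuant (C : comNzRingType) (b a : nat -> C) (d i : nat) : {poly C} :=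
  match d with
  | 0 => 0
  | d'.+1 => match d' with
    | 0 => 1
    | d''.+1 => ('X - (b i)%:P) * continuant b a d' i.+1
                - (a i ^+ 2) *: continuant b a d'' i.+2
    end
  end.

Lemma continuantSS (C : comNzRingType) (b a : nat -> C) d i :
  continuant b a d.+2 i = ('X - (b i)%:P) * continuant b a d.+1 i.+1
     - (a i ^+ 2) *: continuant b a d i.+2.
Proof. by []. Qed.

Lemma eq_jacobi_mx (C : nzRingType) (n : nat) (b a b' a' : nat -> C) :
  (forall i, (1 <= i <= n)%N -> b i = b' i) ->
  (forall i, (1 <= i < n)%N -> a i = a' i) ->
  jacobi_mx n b a = jacobi_mx n b' a'.
Proof.
move=> eqb eqa; apply/matrixP=> i j; rewrite !mxE.
case: eqP => [_|_]; first by rewrite eqb //=.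
case: eqP => [ji|_]; first by rewrite eqa //= -ji.
by case: eqP => [ij|//]; rewrite eqa //= -ij.
Qed.

Lemma char_poly_mx_jacobi (C : comNzRingType) (n : nat) (b a : nat -> C) :
  char_poly_mx (jacobi_mx n b a) =
    jacobi_mx n (fun i => 'X - (b i)%:P) (fun i => - (a i)%:P).
Proof.
apply/matrixP=> i j; rewrite !mxE.
case: eqP => [->|_]; first by rewrite mulr1n.
rewrite mulr0n sub0r.
by case: eqP => [_ //|_]; case: eqP => [_ //|_]; rewrite oppr0.
Qed.

(** Entries are numbered from 1, so offset [i] starts the block at [i.+1]. The signs of the
    off-diagonal entries disappear on squaring. *)
Lemma det_jacobi_continuant (C : comNzRingType) (d i : nat) (b a : nat -> C) :
  \det (jacobi_mx d (fun j => 'X - (b (i + j)%N)%:P) (fun j => - (a (i + j)%N)%:P))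
    = continuant b a d.+1 i.+1.
Proof.
elim/ltn_ind: d i => -[|[|d]] IH i; first by rewrite det_mx00.
  by rewrite det_mx11 mxE /= scaler0 subr0 mulr1 addn1.
rewrite det_jacobi_rec continuantSS addn1 sqrrN -polyC_exp -mul_polyC.
rewrite -(IH d.+1) // -(IH d) //; congr (_ * _ - _ * _);
  apply: (congr1 (@determinant _ _)); apply: eq_jacobi_mx => j _ /=; by rewrite ?addnS ?addSn.
Qed.

Lemma char_poly_jacobi (C : comNzRingType) (n : nat) (b a : nat -> C) :
  char_poly (jacobi_mx n b a) = continuant b a n.+1 1.
Proof. by rewrite /char_poly char_poly_mx_jacobi -(det_jacobi_continuant n 0). Qed.

(** * Degree, coprimality and splitting of continuants *)

Section Continuant.
Variables (C : fieldType).
Implicit Types (b a : nat -> C).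

Lemma size_continuant b a d i : size (continuant b a d i) = d.
Proof.
elim/ltn_ind: d i => -[|[|d]] IH i; rewrite ?size_poly0 ?size_poly1 //.
have K0 : continuant b a d.+1 i.+1 != 0 by rewrite -size_poly_eq0 IH.
have Ep : size (('X - (b i)%:P) * continuant b a d.+1 i.+1) = d.+2.
  by rewrite size_monicM ?monicXsubC // size_XsubC IH.
rewrite continuantSS size_polyDl Ep //.
by rewrite size_polyN (leq_ltn_trans (size_scale_leq _ _)) // IH.
Qed.

Lemma monic_continuant b a d i : continuant b a d.+1 i \is monic.
Proof.
elim: d i => [|d IH] i; first exact: monic1.
have K0 : continuant b a d.+1 i.+1 != 0 by rewrite -size_poly_eq0 size_continuant.
rewrite continuantSS monicE lead_coefDl.
  by rewrite lead_coef_monicM ?monicXsubC // (monicP (IH _)).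
rewrite size_monicM ?monicXsubC // size_XsubC size_continuant.
by rewrite size_polyN (leq_ltn_trans (size_scale_leq _ _)) // size_continuant.
Qed.

(** Euclid's algorithm: modulo the second polynomial, the first is a nonzero multiple of the next
    continuant, and the descent ends at 1. *)
Lemma coprimep_continuant b a d i :
  (forall j, (i <= j < i + d.-1)%N -> a j != 0) ->
  coprimep (continuant b a d.+1 i) (continuant b a d i.+1).
Proof.
elim: d i => [|d IH] i a0; first by rewrite coprimep0 eqpxx.
rewrite continuantSS coprimep_sym coprimep_addl_mul.
rewrite -scaleNr; case: d => [|d] in IH a0 *; first by rewrite coprime1p.
rewrite coprimepZr ?oppr_eq0 ?expf_neq0 ?a0 //=; last by lia.
by apply: IH => j hj; apply: a0; lia.
Qed.

(** One division step yields [b i], [a i ^+ 2] and the next pair of continuants. Continuants involve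
    only the squares of the [a j], so signs are settled elsewhere. *)
Lemma continuant_inj b a b' a' d i :
  (forall j, (i <= j < i + d.-1)%N -> a j != 0) ->
  continuant b a d.+1 i = continuant b' a' d.+1 i ->
  continuant b a d i.+1 = continuant b' a' d i.+1 ->
  (forall j, (i <= j < i + d)%N -> b j = b' j) /\
  (forall j, (i <= j < i + d.-1)%N -> a j ^+ 2 = a' j ^+ 2).
Proof.
elim: d i => [|d IH] i a0 E1 E0; first by split=> j; lia.
have K0 : continuant b' a' d.+1 i.+1 != 0 by rewrite -size_poly_eq0 size_continuant.
move: E1; rewrite !continuantSS E0 => E1.
(* Difference of the two recurrences. A nonzero left side would have size [d.+1], while the right
   side has size at most [d]. *)
have E2 : (b' i - b i) *: continuant b' a' d.+1 i.+1 =
   a i ^+ 2 *: continuant b a d i.+2 - a' i ^+ 2 *: continuant b' a' d i.+2.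
  apply/eqP; rewrite -subr_eq0 -mul_polyC polyCB.
  rewrite -(subrr (('X - (b' i)%:P) * continuant b' a' d.+1 i.+1
    - a' i ^+ 2 *: continuant b' a' d i.+2)) -{1}E1; apply/eqP; ring.
have bi : b i = b' i.
  apply/eqP; rewrite eq_sym -subr_eq0; apply/negP=> /negP bi.
  have := congr1 (fun p : {poly C} => size p) E2.
  rewrite size_scale // size_continuant => E3.
  have : (size (a i ^+ 2 *: continuant b a d i.+2
                - a' i ^+ 2 *: continuant b' a' d i.+2)%R <= d)%N.
    rewrite (leq_trans (size_polyD _ _)) // geq_max size_polyN.
    by rewrite !(leq_trans (size_scale_leq _ _)) ?size_continuant.
  by rewrite -E3 ltnn.
have {}E2 : a i ^+ 2 *: continuant b a d i.+2 = a' i ^+ 2 *: continuant b' a' d i.+2.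
  by apply/eqP; rewrite -subr_eq0 -E2 bi subrr scale0r.
case: d => [|d] in IH a0 E0 E1 E2 K0 *.
  by split=> j hj; [have -> : j = i by lia | lia].
have ai : a i ^+ 2 = a' i ^+ 2.
  have /(congr1 (fun p : {poly C} => lead_coef p)) := E2.
  by rewrite !lead_coefZ !(monicP (monic_continuant _ _ _ _)) !mulr1.
have E3 : continuant b a d.+1 i.+2 = continuant b' a' d.+1 i.+2.
  by apply: (scalerI (a := a i ^+ 2)); rewrite ?{2}ai // expf_neq0 // a0 //; lia.
have a0S j : (i.+1 <= j < i.+1 + d)%N -> a j != 0 by move=> hj; apply: a0; lia.
have [IHb IHa] := IH _ a0S E0 E3.
split=> j hj; (have [->//|ji] := eqVneq j i); [apply: IHb|apply: IHa]; lia.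
Qed.

(* The leading block's continuant, growing at its end: [leading b a m.+1] is the
   characteristic polynomial of the leading m x m block. *)
Fixpoint leading b a (m : nat) : {poly C} :=
  match m with
  | 0 => 0
  | m'.+1 => match m' with
    | 0 => 1
    | m''.+1 => ('X - (b m')%:P) * leading b a m' - (a m'' ^+ 2) *: leading b a m''
    end
  end.

Lemma leadingSS b a m :
  leading b a m.+2 = ('X - (b m.+1)%:P) * leading b a m.+1
     - (a m ^+ 2) *: leading b a m.
Proof. by []. Qed.

Lemma coprimep_leading b a m :
  (forall j, (1 <= j < m)%N -> a j != 0) ->
  coprimep (leading b a m.+1) (leading b a m).
Proof.
elim: m => [|m IH] a0; first by rewrite coprimep0 eqpxx.
rewrite leadingSS coprimep_sym coprimep_addl_mul -scaleNr.
case: m => [|m] in IH a0 *; first by rewrite coprime1p.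
rewrite coprimepZr ?oppr_eq0 ?expf_neq0 ?a0 //=.
by apply: IH => j hj; apply: a0; lia.
Qed.

Lemma eq_leading b a b' a' m :
  (forall i, (1 <= i < m)%N -> b i = b' i) ->
  (forall i, (1 <= i < m.-1)%N -> a i = a' i) ->
  leading b a m = leading b' a' m.
Proof.
elim/ltn_ind: m => -[|[|m]] IH eqb eqa //.
rewrite !leadingSS eqb ?ltnS ?leqnn // IH //; first last.
- by move=> j hj; apply: eqa; lia.
- by move=> j hj; apply: eqb; lia.
(* At the bottom, [a 0] occurs only as a factor of [leading b a 0 = 0]. *)
case: m => [|m] in IH eqb eqa *; first by rewrite !scaler0.
rewrite eqa ?IH //=.
- by move=> j hj; apply: eqb; lia.
- by move=> j hj; apply: eqa => /=; lia.
Qed.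

(** Induction moves the cut by one index, using the recurrence of [continuant] at its head and that
    of [leading] at its end. *)
Lemma continuant_split b a m d :
  continuant b a (m + d).+1 1 =
    leading b a m.+1 * continuant b a d.+1 m.+1
    - leading b a m * (a m ^+ 2 *: continuant b a d m.+2).
Proof.
elim: m d => [|m IH] d; first by rewrite mul1r mul0r subr0.
rewrite addSnnS IH leadingSS continuantSS -!mul_polyC; ring.
Qed.
End Continuant.

(** * Counting zeros with multiplicity *)

Lemma dvdp_prod_coprime (F : fieldType) (I : finType) (p : I -> {poly F}) (q : {poly F}) :
  (forall i j, i != j -> coprimep (p i) (p j)) ->
  (forall i, p i %| q) -> \prod_i p i %| q.
Proof.
move=> cop dvd; have := index_enum_uniq I.
elim: (index_enum I) => [|i s IH] /=; first by rewrite big_nil dvd1p.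
case/andP=> i_s s_uniq; rewrite big_cons Gauss_dvdp ?dvd ?IH //.
rewrite big_seq; apply: (big_ind (coprimep (p i))).
- exact: coprimep1.
- by move=> u v hu hv; rewrite coprimepMr hu.
- by move=> j js; apply: cop; apply: contraNneq i_s => ->.
Qed.

Lemma sum_multiplicities_lt_size (F : fieldType) (I : finType) (x : I -> F) (m : I -> nat)
    (p : {poly F}) :
  injective x -> p != 0 -> (forall i, ('X - (x i)%:P) ^+ m i %| p) ->
  (\sum_i m i < size p)%N.
Proof.
move=> x_inj p0 dvd.
have := @dvdp_prod_coprime _ _ (fun i => ('X - (x i)%:P) ^+ m i) p.
have -> : (\sum_i m i).+1 = size (\prod_i ('X - (x i)%:P) ^+ m i).
  elim: (index_enum I) => [|i s IH]; first by rewrite !big_nil size_poly1.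
  rewrite !big_cons size_monicM ?monic_exp ?monicXsubC //.
    by rewrite size_exp_XsubC -IH -addnS.
  by rewrite -size_poly_eq0 -IH.
move=> H; apply: dvdp_leq => //; apply: H => // i j ij.
apply/coprimep_expl/coprimep_expr/coprimep_XsubC2.
by rewrite subr_eq0 (inj_eq x_inj) eq_sym.
Qed.

(** * Real polynomials and the Wronskian argument *)

Section RealInterpolation.
Variable C : numClosedFieldType.
Implicit Types (p q s : {poly C}) (b a : nat -> C).

Definition real_poly p := map_poly Num.conj p = p.

Lemma real_polyB p q : real_poly p -> real_poly q -> real_poly (p - q).
Proof. by rewrite /real_poly rmorphB /= => -> ->. Qed.

Lemma real_polyM p q : real_poly p -> real_poly q -> real_poly (p * q).
Proof. by rewrite /real_poly rmorphM /= => -> ->. Qed.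

Lemma real_polyZ c p : c \is Num.real -> real_poly p -> real_poly (c *: p).
Proof. by rewrite /real_poly map_polyZ /= => /conj_Creal -> ->. Qed.

Lemma real_continuant b a d i :
  (forall j, (i <= j < i + d.-1)%N -> b j \is Num.real) ->
  (forall j, (i <= j < i + d.-2)%N -> a j \is Num.real) ->
  real_poly (continuant b a d i).
Proof.
elim/ltn_ind: d i => -[|[|d]] IH i rb ra.
- by rewrite /real_poly rmorph0.
- by rewrite /real_poly rmorph1.
rewrite continuantSS; apply: real_polyB.
  apply: real_polyM.
    rewrite /real_poly rmorphB /= map_polyX map_polyC /= conj_Creal //.
    by apply: rb => /=; lia.
  by apply: IH => // j hj; [apply: rb|apply: ra] => /=; lia.
case: d => [|d] in IH rb ra *; first by rewrite scaler0 /real_poly rmorph0.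
apply: real_polyZ; first by apply/rpredX/ra => /=; lia.
by apply: IH => // j hj; [apply: rb|apply: ra] => /=; lia.
Qed.

(** Conjugating coefficients is a ring morphism that fixes [p], so it carries one divisibility to
    the other. *)
Lemma real_poly_root_conj p z m :
  real_poly p -> ('X - z%:P) ^+ m %| p -> ('X - (z^*)%:P) ^+ m %| p.
Proof.
move=> rp; rewrite -(dvdp_map (@Num.conj C)) rp rmorphXn rmorphB /=.
by rewrite map_polyX map_polyC.
Qed.

(* The differences [p * q - u * s] and [p * q' - u * s'] vanish on the z_j, and
   [p], [u] are coprime, so the Wronskian [q * s' - q' * s] vanishes there too;
   being real it also vanishes on the conjugates, that is on 2r points. *)
Lemma wronskian_eq0 (I : finType) (z : I -> C) (l : I -> nat) p u q s q' s' :
  injective z -> (forall j, 0 < 'Im (z j)) -> coprimep p u ->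
  real_poly q -> real_poly s -> real_poly q' -> real_poly s' ->
  (size q <= (\sum_j l j).+1)%N -> (size s <= \sum_j l j)%N ->
  (size q' <= (\sum_j l j).+1)%N -> (size s' <= \sum_j l j)%N ->
  (forall j, ('X - (z j)%:P) ^+ l j %| p * q - u * s) ->
  (forall j, ('X - (z j)%:P) ^+ l j %| p * q' - u * s') ->
  q * s' = q' * s.
Proof.
move=> z_inj z_im cop rq rs rq' rs' szq szs szq' szs' dvd dvd'.
set r := (\sum_j l j)%N in szq szs szq' szs'.
apply/eqP; rewrite -subr_eq0; apply/negP=> /negP W0.
(* The boolean selects a point or its conjugate; the two families are disjoint because all [z j] lie
   in the open upper half-plane. *)
pose x (i : bool * I) := if i.1 then z i.2 else (z i.2)^*.
have x_inj : injective x.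
  have zNconj i j : z i <> (z j)^*.
    move=> /(congr1 (fun c => 'Im c)); rewrite Im_conj => /eqP.
    by rewrite -subr_eq0 opprK gt_eqF // addr_gt0.
  move=> [[] i] [[] j]; rewrite /x /=.
  - by move/z_inj->.
  - by move/zNconj.
  - by move/esym/zNconj.
  - by move/(can_inj conjCK)/z_inj->.
have dvdW j : ('X - (z j)%:P) ^+ l j %| q * s' - q' * s.
  set e := _ ^+ _.
  have d1 : e %| p * (q * s' - q' * s).
    have -> : p * (q * s' - q' * s) =
      (p * q - u * s) * s' - (p * q' - u * s') * s by ring.
    by rewrite dvdp_sub // dvdp_mulr ?dvd ?dvd'.
  have d2 : e %| u * (q * s' - q' * s).
    have -> : u * (q * s' - q' * s) =
      (p * q - u * s) * q' - (p * q' - u * s') * q by ring.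
    by rewrite dvdp_sub // dvdp_mulr ?dvd ?dvd'.
  have : e %| gcdp (p * (q * s' - q' * s)) (u * (q * s' - q' * s)).
    by rewrite dvdp_gcd d1.
  (* As [p] and [u] are coprime, the gcd of these two multiples of the Wronskian is the Wronskian
     itself, up to a unit. *)
  rewrite (eqp_dvdr _ (gcdp_mul2r _ _ _)).
  by move: cop; rewrite -gcdp_eqp1 => /(eqp_mulr _)/(eqp_dvdr _) ->; rewrite mul1r.
have := @sum_multiplicities_lt_size _ _ x (fun i => l i.2) _ x_inj W0.
rewrite ltnNge => /(_ _)/negP; apply.
  move=> [[] j]; rewrite /x /=; first exact: dvdW.
  apply: real_poly_root_conj; last exact: dvdW.
  by apply: real_polyB; apply: real_polyM.
rewrite -(pair_bigA _ (fun _ j => l j)) /= big_bool /= -/r.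
rewrite (leq_trans (size_polyD _ _)) // geq_max size_polyN.
have size_le (v w : {poly C}) : (size v <= r.+1)%N -> (size w <= r)%N ->
    (size (v * w)%R <= r + r)%N.
  move=> hv hw; rewrite (leq_trans (size_polyMleq _ _)) // -subn1 leq_subLR.
  by rewrite add1n -addSn leq_add.
by rewrite !size_le.
Qed.

(** By Gauss, [q] and [q'] divide each other; being monic they are equal, and then [q] cancels. *)
Lemma coprime_cross_eq q s q' s' :
  q \is monic -> q' \is monic -> coprimep q s -> coprimep q' s' ->
  q * s' = q' * s -> q = q' /\ s = s'.
Proof.
move=> mq mq' cop cop' E.
have qq' : q = q'.
  apply/eqP; rewrite -eqp_monic // /eqp.
  rewrite -(Gauss_dvdpl _ cop) -E dvdp_mulr //=.
  by rewrite -(Gauss_dvdpl _ cop') E dvdp_mulr.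
by split=> //; apply: (mulfI (monic_neq0 mq)); rewrite E qq'.
Qed.

(** * Recovering the unknown entries *)

Lemma jacobi_mx_unique (I : finType) (z : I -> C) (l : I -> nat) b a b' a' n r :
  injective z -> (forall j, 0 < 'Im (z j)) ->
  r = (\sum_j l j)%N -> (r < n)%N ->
  (forall i, (2 <= i <= n)%N -> b i \is Num.real) ->
  (forall i, (1 <= i < n)%N -> 0 < a i) ->
  (forall i, (2 <= i <= n)%N -> b' i \is Num.real) ->
  (forall i, (1 <= i < n)%N -> 0 < a' i) ->
  (forall j, ('X - (z j)%:P) ^+ l j %| char_poly (jacobi_mx n b a)) ->
  (forall j, ('X - (z j)%:P) ^+ l j %| char_poly (jacobi_mx n b' a')) ->
  (forall i, (1 <= i <= n - r)%N -> b i = b' i) ->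
  (forall i, (1 <= i < n - r)%N -> a i = a' i) ->
  jacobi_mx n b a = jacobi_mx n b' a'.
Proof.
move=> z_inj z_im rE r_lt rb pa rb' pa' dvd dvd' eqb eqa.
(* The known block has size [m.+1], and [a m.+1] couples it to the trailing block. *)
have [m mr] : exists m, n = (m.+1 + r)%N by exists (n - r).-1; lia.
have nr : (n - r)%N = m.+1 by lia.
move: dvd dvd'; rewrite !char_poly_jacobi mr => dvd dvd'.
pose tail (b1 a1 : nat -> C) := a1 m.+1 ^+ 2 *: continuant b1 a1 r m.+3.
have tailP b1 a1 : (forall i, (2 <= i <= n)%N -> b1 i \is Num.real) ->
    (forall i, (1 <= i < n)%N -> 0 < a1 i) ->
    [/\ real_poly (continuant b1 a1 r.+1 m.+2), real_poly (tail b1 a1) &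
        coprimep (continuant b1 a1 r.+1 m.+2) (tail b1 a1)].
  move=> rb1 pa1; have ra1 i : (1 <= i < n)%N -> a1 i \is Num.real.
    by move/pa1/gtr0_real.
  split.
  - by apply: real_continuant => j hj; [apply: rb1|apply: ra1]; lia.
  (* For [r = 0] the coupling index [m.+1] is [n], outside the matrix, but [tail] is then zero. *)
  - rewrite /tail; case: (posnP r) => [->|r0].
      by rewrite scaler0 /real_poly rmorph0.
    apply: real_polyZ; first by apply/rpredX/ra1; lia.
    by apply: real_continuant => j hj; [apply: rb1|apply: ra1]; lia.
  - have cop : coprimep (continuant b1 a1 r.+1 m.+2) (continuant b1 a1 r m.+3).
      by apply: coprimep_continuant => j hj; rewrite gt_eqF // pa1 //; lia.
    rewrite /tail; case: (posnP r) cop => [->|r0]; first by rewrite scaler0.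
    by rewrite coprimepZr // expf_neq0 // gt_eqF // pa1 //; lia.
have [rq rs cop] := tailP b a rb pa.
have [rq' rs' cop'] := tailP b' a' rb' pa'.
have size_tail b1 a1 : (size (tail b1 a1) <= \sum_j l j)%N.
  by rewrite (leq_trans (size_scale_leq _ _)) // size_continuant -rE.
have lead : leading b a m.+2 = leading b' a' m.+2.
  by apply: eq_leading => i hi; [apply: eqb|apply: eqa]; rewrite nr; lia.
have lead1 : leading b a m.+1 = leading b' a' m.+1.
  by apply: eq_leading => i hi; [apply: eqb|apply: eqa]; rewrite nr; lia.
have E : continuant b a r.+1 m.+2 * tail b' a' = continuant b' a' r.+1 m.+2 * tail b a.
  apply: (wronskian_eq0 (p := leading b a m.+2) (u := leading b a m.+1) z_inj z_im) => //.
  - by apply: coprimep_leading => j hj; rewrite gt_eqF // pa //; lia.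
  - by rewrite size_continuant -rE.
  - by rewrite size_continuant -rE.
  - by move=> j; have := dvd j; rewrite continuant_split.
  - by move=> j; have := dvd' j; rewrite continuant_split lead lead1.
have [EQ ES] := coprime_cross_eq (monic_continuant _ _ _ _) (monic_continuant _ _ _ _)
  cop cop' E.
(* Positivity selects the square root. *)
have sq_inj i : (1 <= i < n)%N -> a i ^+ 2 = a' i ^+ 2 -> a i = a' i.
  by move=> hi /eqP; rewrite eqrXn2 // ?ltW ?pa ?pa' // => /eqP.
(* Continuants of positive size are monic, so the coupling is the leading coefficient of [tail]. *)
have am : (0 < r)%N -> a m.+1 ^+ 2 = a' m.+1 ^+ 2.
  move=> r0; have := congr1 (fun p : {poly C} => lead_coef p) ES.
  rewrite /tail !lead_coefZ -(prednK r0).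
  by rewrite !(monicP (monic_continuant _ _ _ _)) !mulr1.
have EK : continuant b a r m.+3 = continuant b' a' r m.+3.
  case: (posnP r) => [->//|r0]; apply: (scalerI (a := a m.+1 ^+ 2)).
    by rewrite expf_neq0 // gt_eqF // pa //; lia.
  by rewrite [in RHS]am.
have [|tb ta] := continuant_inj _ EQ EK.
  by move=> j hj; rewrite gt_eqF // pa //; lia.
rewrite -mr; apply: eq_jacobi_mx => i hi.
  by have [im|im] := leqP i m.+1; [apply: eqb|apply: tb]; lia.
have [im|im] := ltnP i m.+1; first by apply: eqa; lia.
apply: sq_inj => //; have [->|ne] := eqVneq i m.+1; first by apply: am; lia.
by apply: ta; lia.
Qed.
End RealInterpolation.

(* In R[i], 0 < x means that x is real and positive. *)
Theorem theorem5p5 (R : realType) (n k r : nat)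
    (z : 'I_k -> R[i]) (l : 'I_k -> nat)
    (b a b' a' : nat -> R[i])
    (n_gt0 : (0 < n)%N)
    (z_distinct : injective z)
    (z_im : forall j, 0 < complex.Im (z j))
    (l_gt0 : forall j, (0 < l j)%N)
    (r_def : r = (\sum_(j < k) l j)%N)
    (r_le : (r <= n - 1)%N)
    (b1_im : 0 < complex.Im (b 1%N))
    (b_real : forall i, (2 <= i <= n)%N -> b i \is Num.real)
    (a_gt0 : forall i, (1 <= i <= n - 1)%N -> 0 < a i)
    (b1_im' : 0 < complex.Im (b' 1%N))
    (b_real' : forall i, (2 <= i <= n)%N -> b' i \is Num.real)
    (a_gt0' : forall i, (1 <= i <= n - 1)%N -> 0 < a' i)
    (eig : forall j, eigenvalue_of_multiplicity (jacobi_mx n b a) (z j) (l j))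
    (eig' : forall j,
       eigenvalue_of_multiplicity (jacobi_mx n b' a') (z j) (l j))
    (same_b : forall i, (1 <= i <= n - r)%N -> b i = b' i)
    (same_a : forall i, (1 <= i <= n - r - 1)%N -> a i = a' i) :
  jacobi_mx n b a = jacobi_mx n b' a'.
Proof.
have dvd (b1 a1 : nat -> R[i]) j :
    eigenvalue_of_multiplicity (jacobi_mx n b1 a1) (z j) (l j) ->
    ('X - (z j)%:P) ^+ l j %| char_poly (jacobi_mx n b1 a1).
  by case=> _ mE; rewrite -mup_geq ?mE // monic_neq0 ?char_poly_monic.
apply: (jacobi_mx_unique z_distinct _ r_def) => //.
(* ['Im] takes values in [R[i]], [complex.Im] in [R]. *)
- by move=> j; rewrite -complexIm ltcR.
- by lia.
- by move=> i hi; apply: a_gt0; lia.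
- by move=> i hi; apply: a_gt0'; lia.
- by move=> j; apply: dvd.
- by move=> j; apply: dvd.
- by move=> i hi; apply: same_a; lia.
Qed.
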